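(* Let $P$ be an irreducible stochastic matrix over a countable set $\Omega_P$, and let $Q$ be a stochastic matrix over a countable set $\Omega_Q$. Then $Q$ is Doob equivalent to $P$ if and only if $Q$ is conjugate to a (generalized) Doob transform $P^{(h,\lambda)}$ of $P$, for some function $h:\Omega_P\to(0,\infty)$ and some $\lambda>0$ with $Ph=\lambda h$.
   Context: A stochastic matrix over a countable set $\Omega$ is a function $P:\Omega\times\Omega\to[0,1]$ with $\sum_{j\in\Omega}P_{ij}=1$ for all $i\in\Omega$. Write $P_{ij}^{(n)}=(P^n)_{ij}$ for $n\in\mathbb N=\{0,1,2,\dots\}$, with $P^{(0)}=I$ the identity matrix. For a stochastic matrix $P$, $\mathrm{Gr}(P)$ is the directed graph on $\Omega$ with a directed edge $(i,j)$ exactly when $P_{ij}>0$; $(i,j)\in \mathrm{Gr}(P)$ means that $(i,j)$ is an edge. $P$ is irreducible if $\mathrm{Gr}(P)$ is strongly connected. Conjugacy: stochastic matrices $P$ over $\Omega_P$ and $Q$ over $\Omega_Q$ are conjugate, $P\cong Q$, if there is a bijection $\sigma:\Omega_P\to\Omega_Q$ with $P_{ij}=Q_{\sigma(i)\sigma(j)}$ for every $(i,j)\in\mathrm{Gr}(P)$. Doob equivalence: $P$ and $Q$ are Doob equivalent, $P\sim_d Q$, if there is a bijection $\sigma:\Omega_P\to\Omega_Q$ which is a graph isomorphism between $\mathrm{Gr}(P)$ and $\mathrm{Gr}(Q)$ such that for all $n,m\in\mathbb N$, all $(i,k)\in\mathrm{Gr}(P^{n+m})$ and all $j\in\Omega_P$,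 $$\frac{P_{ij}^{(n)}P_{jk}^{(m)}}{P_{ik}^{(n+m)}}=\frac{Q_{\sigma(i)\sigma(j)}^{(n)}Q_{\sigma(j)\sigma(k)}^{(m)}}{Q_{\sigma(i)\sigma(k)}^{(n+m)}}.$$ Doob transform: if $h:\Omega\to(0,\infty)$ satisfies $Ph=\lambda h$, i.e. $\sum_j P_{ij}h(j)=\lambda h(i)$ for all $i$ (so necessarily $\lambda>0$), the (generalized) Doob transform of $P$ by $(h,\lambda)$ is the stochastic matrix $P^{(h,\lambda)}$ over $\Omega$ given by $P^{(h,\lambda)}_{ij}=\lambda^{-1}\frac{h(j)}{h(i)}P_{ij}$ for $i,j\in\Omega$. *)

(* Defs.v *)
From mathcomp Require Import all_boot all_order all_algebra.
From mathcomp Require Import all_classical all_reals all_analysis.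

Set Implicit Arguments.
Unset Strict Implicit.
Unset Printing Implicit Defensive.

Import Order.TTheory GRing.Theory Num.Theory.

Local Open Scope classical_set_scope.
Local Open Scope ring_scope.

Section Matrices.
Context {R : realType}.
Implicit Types T S : countType.

Definition stochastic T (P : T -> T -> R) : Prop :=
  (forall i j, 0 <= P i j <= 1) /\
  (forall i, \esum_(j in [set: T]) (P i j)%:E = 1%E).

(* For stochastic P every sum below lies in [0, 1], so [fine] loses nothing. *)
Fixpoint mpow T (P : T -> T -> R) (n : nat) (i j : T) : R :=
  if n is m.+1 then fine (\esum_(k in [set: T]) (mpow P m i k * P k j)%:E)
  else (i == j)%:R.

Definition Gr T (P : T -> T -> R) : rel T := fun i j => 0 < P i j.

Definition strongly_connected T (e : rel T) : Prop :=
  forall i j, exists2 s : seq T, path e i s & last i s = j.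

Definition irreducible T (P : T -> T -> R) : Prop :=
  strongly_connected (Gr P).

Definition conjugate T S (P : T -> T -> R) (Q : S -> S -> R) : Prop :=
  exists2 sigma : T -> S, bijective sigma &
    forall i j, Gr P i j -> P i j = Q (sigma i) (sigma j).

Definition Doob_equivalent T S (P : T -> T -> R) (Q : S -> S -> R) : Prop :=
  exists sigma : T -> S,
    [/\ bijective sigma,
        (forall i j, Gr P i j = Gr Q (sigma i) (sigma j))
      & forall (n m : nat) (i j k : T), Gr (mpow P (n + m)) i k ->
          mpow P n i j * mpow P m j k / mpow P (n + m) i k
          = mpow Q n (sigma i) (sigma j) * mpow Q m (sigma j) (sigma k)
            / mpow Q (n + m) (sigma i) (sigma k)].

(* P h = lambda h. The sum is taken in the extended reals, so the equation
   includes convergence; esum is the genuine sum only for nonnegative terms,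
   which is the case here since it is used with P >= 0 and h > 0. *)
Definition eigenfunction T (P : T -> T -> R) (h : T -> R) (lambda : R) : Prop :=
  forall i, \esum_(j in [set: T]) (P i j * h j)%:E = (lambda * h i)%:E.

Definition Doob_transform T (P : T -> T -> R) (h : T -> R) (lambda : R) :
    T -> T -> R :=
  fun i j => lambda^-1 * (h j / h i) * P i j.

End Matrices.

(* Main.v *)
(* In Gr(P^n), the ratio c_n(i,j) = Q^n_ij / P^n_ij satisfies
   c_(n+m)(i,k) = c_n(i,j) c_m(j,k): this is Doob equivalence. On the return
   times of a base point o, n |-> c_n(o,o) is therefore a homomorphism, equal to
   lambda^-n, and h(i) = lambda^n c_n(o,i) does not depend on n, because
   lambda^m c_m(i,o) is its inverse for every m. Taking n = 1, Q is the Doob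
   transform of P by (h, lambda), and Q 1 = 1 says that P h = lambda h.
   Conversely, powers of a Doob transform are rescaled by a factor
   lambda^-n h(j) / h(i), which cancels from the ratios. *)
Require Import Defs.
From mathcomp Require Import all_boot all_order all_algebra.
From mathcomp Require Import all_classical all_reals all_analysis.
From mathcomp Require Import ring.

Import Order.TTheory GRing.Theory Num.Theory.
Local Open Scope ring_scope.

(** * Sums of nonnegative families over a countable index set *)

Section Esum.
Context {R : realType}.
Implicit Types T S : choiceType.

(** One inequality holds because [c] factors out of every finite partial sum; the other is the same
    inequality for the factor [c^-1] and the family [c * a]. *)
Lemma esumZ T (a : T -> \bar R) (c : R) :
  0 < c -> (forall i, (0 <= a i)%E) ->
  (\esum_(i in [set: T]) (c%:E * a i) = c%:E * \esum_(i in [set: T]) a i)%E.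
Proof.
have le_esumZ (b : T -> \bar R) (d : R) : 0 < d -> (forall i, (0 <= b i)%E) ->
    (\esum_(i in [set: T]) (d%:E * b i) <= d%:E * \esum_(i in [set: T]) b i)%E.
  move=> d0 b0; apply: ge_ereal_sup => _ [A finA <-].
  rewrite -ge0_mule_fsumr// lee_pmul2l//.
  by apply: ereal_sup_ubound; exists A.
move=> c0 a0; apply/eqP; rewrite eq_le le_esumZ//=.
have aE : a = (fun i => c^-1%:E * (c%:E * a i))%E.
  by apply/funext => i; rewrite muleA -EFinM mulVf ?mul1e// gt_eqF.
rewrite {1}aE -lee_pdivlMl//; apply: le_esumZ; first by rewrite invr_gt0.
by move=> i; rewrite mule_ge0// lee_fin ltW.
Qed.

Lemma le_term_esum T (a : T -> \bar R) i :
  (forall j, (0 <= a j)%E) -> (a i <= \esum_(j in [set: T]) a j)%E.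
Proof.
move=> a0; apply: esum_ge; exists [set i]%classic; last by rewrite fsbig_set1.
by split => //; exact: finite_set1.
Qed.

Lemma exchange_esum T S (a : T -> S -> \bar R) :
  (forall i j, (0 <= a i j)%E) ->
  \esum_(i in [set: T]) \esum_(j in [set: S]) a i j =
  \esum_(j in [set: S]) \esum_(i in [set: T]) a i j.
Proof.
move=> a0; rewrite !esum_esum//.
apply: (reindex_esum _ _ (fun p : S * T => (p.2, p.1))).
by split=> [[]|[? ?] [? ?] _ _ /= [-> ->]|[i j] _] //; exists (j, i).
Qed.

Lemma bijective_setT_bij T S (f : T -> S) :
  bijective f -> set_bij [set: T] [set: S] f.
Proof.
move=> [g fK gK]; split=> [//|i j _ _ /(can_inj fK)//|j _].
by exists (g j).
Qed.

(** The nonnegative differences [b - a] have a sum [s] with [1 + s = 1]; hence [s] is finite and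
    zero, and it bounds each difference. This later upgrades an equality known on edges only to all
    entries of a row. *)
Lemma esum_dominated_eq T (a b : T -> R) :
  (forall i, 0 <= a i <= b i) ->
  \esum_(i in [set: T]) (a i)%:E = 1%E -> \esum_(i in [set: T]) (b i)%:E = 1%E ->
  a =1 b.
Proof.
move=> ab sa sb i.
have d0 j : (0 <= (b j - a j)%:E)%E by rewrite lee_fin subr_ge0; case/andP: (ab j).
have : \esum_(j in [set: T]) (b j - a j)%:E = 0%E.
  have : \esum_(j in [set: T]) ((a j)%:E + (b j - a j)%:E)%E = 1%E.
    by rewrite -sb; apply: eq_esum => j _; rewrite -EFinD addrC subrK.
  rewrite esumD//; last by move=> j _; rewrite lee_fin; case/andP: (ab j).
  rewrite sa; case: (esum _ _) => [r||]//=.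
  by rewrite -EFinD => -[/eqP]; rewrite -subr_eq0 [1 + r]addrC addrK => /eqP->.
move=> s0; apply/eqP; rewrite eq_le; case/andP: (ab i) => _ -> /=.
rewrite -subr_le0 -lee_fin -[leRHS]/0%E -s0.
exact: (le_term_esum T (fun j => (b j - a j)%:E)).
Qed.

End Esum.

(** * Powers of a stochastic matrix and the positivity of their entries *)

Section StochasticPowers.
Context {R : realType} {T : countType}.
Context (P : T -> T -> R) (stochP : stochastic P).

Lemma stochastic_ge0 i j : 0 <= P i j.
Proof. by case: stochP => /(_ i j)/andP[]. Qed.

Lemma stochastic_le1 i j : P i j <= 1.
Proof. by case: stochP => /(_ i j)/andP[]. Qed.

Lemma esum_step_fin_num (a : T -> R) j :
  (forall i, 0 <= a i) -> \esum_(i in [set: T]) (a i)%:E = 1%E ->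
  \esum_(i in [set: T]) (a i * P i j)%:E \is a fin_num.
Proof.
move=> a0 a1; rewrite ge0_fin_numE; last first.
  by apply: esum_ge0 => i _; rewrite lee_fin mulr_ge0// stochastic_ge0.
apply: (@le_lt_trans _ _ 1%E); rewrite ?ltry// -a1; apply: le_esum => i _.
by rewrite lee_fin ler_piMr// stochastic_le1.
Qed.

(** Both properties go through one induction: they make the sums defining the next power finite, so
    that [fine] is harmless, and Tonelli then gives its row sums. *)
Lemma mpow_row n :
  (forall i j, 0 <= mpow P n i j) /\
  (forall i, \esum_(j in [set: T]) (mpow P n i j)%:E = 1%E).
Proof.
elim: n => [|n [M0 M1]].
  split=> [i j|i] /=; first by rewrite ler0n.
  rewrite -[RHS](esum_set1 (t := i) (a := fun=> 1%E)) ?lee01// [RHS]esum_mkcond.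
  apply: eq_esum => j _; rewrite eq_sym.
  by case: eqP => [->|ne]; [rewrite mem_set|rewrite memNset].
have MP0 i k j : (0 <= (mpow P n i k * P k j)%:E)%E.
  by rewrite lee_fin mulr_ge0// stochastic_ge0.
split=> [i j|i] /=; first by rewrite fine_ge0// esum_ge0.
transitivity (\esum_(j in [set: T]) \esum_(k in [set: T]) (mpow P n i k * P k j)%:E).
  by apply: eq_esum => j _; rewrite fineK// esum_step_fin_num.
rewrite exchange_esum// -(M1 i); apply: eq_esum => k _.
under eq_esum do rewrite EFinM.
(* A zero entry is treated apart, since [esumZ] wants a positive factor. *)
have [->|Mk] := eqVneq (mpow P n i k) 0.
  by rewrite esum1// => j _; rewrite mul0e.
rewrite esumZ ?lt0r ?Mk ?M0//; last by move=> j; rewrite lee_fin stochastic_ge0.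
by case: stochP => _ ->; rewrite mule1.
Qed.

Lemma mpowSE n i j :
  \esum_(k in [set: T]) (mpow P n i k * P k j)%:E = (mpow P n.+1 i j)%:E.
Proof.
by have [M0 M1] := mpow_row n; rewrite fineK// esum_step_fin_num.
Qed.

Lemma mpowS_gt0 n i j :
  0 < mpow P n.+1 i j <-> exists2 k, 0 < mpow P n i k & 0 < P k j.
Proof.
have [M0 _] := mpow_row n.
have MP0 k : (0 <= (mpow P n i k * P k j)%:E)%E.
  by rewrite lee_fin mulr_ge0// stochastic_ge0.
split=> [|[k Mk Pk]]; last first.
  rewrite -lte_fin -mpowSE (lt_le_trans _ (le_term_esum _ _ k MP0))//.
  by rewrite lte_fin mulr_gt0.
rewrite -lte_fin -mpowSE => s0; apply: contrapT => nok; move: s0.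
rewrite esum1 ?ltxx// => k _; congr EFin; apply/eqP; rewrite mulf_eq0 -implyNb.
apply/implyP => Mk; apply: contrapT => /negP Pk; apply: nok; exists k.
  by rewrite lt0r Mk M0.
by rewrite lt0r Pk stochastic_ge0.
Qed.

Lemma mpow1 i j : mpow P 1 i j = P i j.
Proof.
apply: EFin_inj; rewrite -mpowSE /=.
rewrite -[RHS](esum_set1 (t := i) (a := fun k => (P k j)%:E)) ?lee_fin ?stochastic_ge0//.
rewrite [RHS]esum_mkcond; apply: eq_esum => k _; rewrite eq_sym.
by case: eqP => [->|ne]; [rewrite mem_set ?mul1r|rewrite memNset ?mul0r].
Qed.

Lemma mpow_gt0P n i j :
  0 < mpow P n i j <->
  exists s : seq T, [/\ path (Gr P) i s, last i s = j & size s = n].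
Proof.
elim: n j => [|n IH] j.
  rewrite /= ltr0n lt0b.
  split=> [/eqP <-|[[|? ?] [_ /= <- //]]].
  by exists [::].
rewrite mpowS_gt0; split=> [[k /IH[s [ps ls ss]] Pkj]|[s]].
  by exists (rcons s j); rewrite rcons_path last_rcons size_rcons ps ls ss.
case/lastP: s => [[]//|s x]; rewrite rcons_path last_rcons size_rcons.
move=> [/andP[ps Px] <- [ss]]; exists (last i s) => //.
by apply/IH; exists s.
Qed.

Lemma mpow_gt0_trans n m i j k :
  0 < mpow P n i j -> 0 < mpow P m j k -> 0 < mpow P (n + m) i k.
Proof.
move=> /mpow_gt0P[s [ps <- <-]] /mpow_gt0P[t [pt <- <-]].
by apply/mpow_gt0P; exists (s ++ t); rewrite cat_path last_cat size_cat ps.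
Qed.

(** Strong connectivity allows the empty path when [i = j]. Leaving [i] first by some edge, which
    exists because its row sums to 1, forces a positive length. *)
Lemma irreducible_mpow_gt0 :
  irreducible P -> forall i j, exists2 n, (0 < n)%N & 0 < mpow P n i j.
Proof.
move=> irrP i j.
have [k Pik] : exists k, 0 < P i k.
  apply: contrapT => nok; case: stochP => _ /(_ i); rewrite esum1.
    by move=> /eqP; rewrite eqe eq_sym oner_eq0.
  move=> k _; congr EFin; apply/eqP; apply: contrapT => /negP Pk; apply: nok.
  by exists k; rewrite lt0r Pk stochastic_ge0.
have [s ps ls] := irrP k j.
exists (size s).+1 => //; apply/mpow_gt0P.
exists (k :: s); split=> //=; exact/andP.
Qed.

End StochasticPowers.

(** A one-step graph isomorphism carries over to all powers by induction on the last step, the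
    bijection transporting the intermediate state. *)
Lemma mpow_gt0_iso {R : realType} {T S : countType} (P : T -> T -> R)
    (Q : S -> S -> R) (sigma : T -> S) :
  stochastic P -> stochastic Q -> bijective sigma ->
  (forall i j, Gr P i j = Gr Q (sigma i) (sigma j)) ->
  forall n i j, (0 < mpow P n i j) = (0 < mpow Q n (sigma i) (sigma j)).
Proof.
move=> sP sQ [tau sK tK] iso; elim=> [|n IH] i j.
  by rewrite /= (can_eq sK).
apply/idP/idP => /mpowS_gt0 [] // k Mk Pk; apply/mpowS_gt0 => //.
  by exists (sigma k); rewrite -?IH// -[0 < _]iso.
by exists (tau k); rewrite ?IH ?tK// -[0 < _]/(Gr P _ _) iso tK.
Qed.

(** The matrices are abstracted away: [N n i j] stands for a positive [n]-step entry and [c] for the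
    quotient of two such entries. *)
Lemma cocycle_trivial {R : realType} {T : Type} (N : nat -> T -> T -> Prop)
    (c : nat -> T -> T -> R) :
  (forall n m i j k, N n i j -> N m j k -> N (n + m)%N i k) ->
  (forall n i j, N n i j -> 0 < c n i j) ->
  (forall n m i j k, N n i j -> N m j k -> c (n + m)%N i k = c n i j * c m j k) ->
  (forall i j, exists2 n, (0 < n)%N & N n i j) ->
  exists (h : T -> R) (lambda : R),
    [/\ forall i, 0 < h i, 0 < lambda
      & forall n i j, N n i j -> c n i j = lambda ^- n * (h j / h i)].
Proof.
move=> N_trans c_gt0 cM N_conn.
have [[ o]|noT] := pselect (inhabited T); last first.
  by exists (fun=> 1), 1; split=> // n i; case: noT.
(* Repetitions of a loop are counted from one, because [N 0 o o] is not among the assumptions. *)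
have [n0 n0_gt0 N0] := N_conn o o.
have loopX n : N n o o -> forall k, N (k.+1 * n)%N o o /\
    c (k.+1 * n)%N o o = c n o o ^+ k.+1.
  move=> No; elim=> [|k [IHN IHc]]; first by rewrite mul1n expr1.
  rewrite mulSn; split; first exact: (N_trans _ _ _ _ _ No IHN).
  by rewrite (cM _ _ _ _ _ No IHN) IHc -exprS.
(* The positive [n0]-th root of the value on one loop; its inverse will be [lambda]. *)
pose x := c n0 o o `^ n0%:R^-1.
have x_gt0 : 0 < x by apply/powR_gt0/c_gt0.
(* A loop of length [n] repeated [n0] times and one of length [n0] repeated [n]
   times have the same length, so calibrating [x] on one loop at [o] calibrates
   it on all of them. *)
have loopE n : (0 < n)%N -> N n o o -> c n o o = x ^+ n.
  move=> n_gt0 No.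
  have xX : x ^+ n0 = c n0 o o.
    by rewrite -powR_mulrn ?ltW// -powRrM mulVf ?powRr1 ?ltW ?c_gt0// pnatr_eq0 -lt0n.
  have [_] := loopX n No n0.-1; have [_] := loopX n0 N0 n.-1.
  rewrite !prednK// mulnC => -> /esym/eqP.
  rewrite -xX -!exprM mulnC exprM eqrXn2 ?exprn_ge0 ?ltW ?c_gt0//.
  by move/eqP.
pose p i := xget 0%N [set n | (0 < n)%N /\ N n o i]%classic.
have pP i : (0 < p i)%N /\ N (p i) o i.
  have [n n_gt0 Nn] := N_conn o i.
  by apply: (@xgetPex _ 0%N [set n | (0 < n)%N /\ N n o i]%classic); exists n.
pose h i := x ^- p i * c (p i) o i.
have h_gt0 i : 0 < h i.
  by rewrite mulr_gt0 ?invr_gt0 ?exprn_gt0 ?c_gt0//; case: (pP i).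
have hE n i : N n o i -> c n o i = x ^+ n * h i.
  (* The same return path from [i] closes both paths from [o] into loops, and its factor [c m i o]
     cancels. Its positive length lets [loopE] apply even when [n = 0]. *)
  move=> Nn; have [p_gt0 Np] := pP i; have [m m_gt0 Nm] := N_conn i o.
  have cm0 : c m i o != 0 by rewrite gt_eqF ?c_gt0.
  have E1 := cM _ _ _ _ _ Nn Nm; have E2 := cM _ _ _ _ _ Np Nm.
  rewrite loopE ?addn_gt0 ?m_gt0 ?orbT// in E1; last exact: (N_trans _ _ _ _ _ Nn Nm).
  rewrite loopE ?addn_gt0 ?m_gt0 ?orbT// in E2; last exact: (N_trans _ _ _ _ _ Np Nm).
  apply: (mulIf cm0); rewrite -E1 /h -!mulrA -E2 !exprD mulKf//.
  by rewrite gt_eqF// exprn_gt0.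
clearbody h; exists h, x^-1; split=> // [|n i j Nn]; first by rewrite invr_gt0.
have [_ Np] := pP i.
(* Prolonging a path from [o] to [i] by the given one to [j] compares [h i] with [h j]. *)
have := cM _ _ _ _ _ Np Nn; rewrite (hE _ _ Np) (hE _ _ (N_trans _ _ _ _ _ Np Nn)).
have xp : x ^+ p i != 0 by rewrite gt_eqF ?exprn_gt0.
have hi : h i != 0 by rewrite gt_eqF.
rewrite exprVn invrK exprD -!mulrA => /(mulfI xp) E.
by apply: (mulfI hi); rewrite -E mulrCA; congr (_ * _); rewrite mulrCA divff ?mulr1.
Qed.

Section DoobTransform.
Context {R : realType} {T : countType}.
Context (P : T -> T -> R) (h : T -> R) (lambda : R).
Context (stochP : stochastic P) (h_gt0 : forall i, 0 < h i)
  (lambda_gt0 : 0 < lambda).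

Lemma Doob_transform_ge0 i j : 0 <= Doob_transform P h lambda i j.
Proof.
by rewrite !mulr_ge0 ?invr_ge0 ?stochastic_ge0// ltW.
Qed.

(** The row sum at [k] is the value of [P h] at [k] divided by [lambda * h k]. *)
Lemma Doob_transform_row :
  eigenfunction P h lambda <->
  forall i, \esum_(j in [set: T]) (Doob_transform P h lambda i j)%:E = 1%E.
Proof.
have rowE k : \esum_(j in [set: T]) (Doob_transform P h lambda k j)%:E =
    ((lambda * h k)^-1%:E * \esum_(j in [set: T]) (P k j * h j)%:E)%E.
  rewrite -esumZ ?invr_gt0 ?mulr_gt0//; last first.
    by move=> j; rewrite lee_fin mulr_ge0 ?stochastic_ge0// ltW.
  apply: eq_esum => j _; rewrite -EFinM; congr EFin.
  by rewrite /Doob_transform invfM; ring.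
have lh0 k : lambda * h k != 0 by rewrite gt_eqF ?mulr_gt0.
split=> [eig k|row k]; first by rewrite rowE eig -EFinM mulVf.
have := row k; rewrite rowE => /(congr1 (fun y => (lambda * h k)%:E * y)%E).
by rewrite muleA -EFinM divff// mul1e mule1.
Qed.

(** In each product of the matrix multiplication, the values of [h] at the intermediate state
    cancel. *)
Lemma mpow_Doob_transform {S : countType} (Q : S -> S -> R) (sigma : S -> T) :
  stochastic Q -> bijective sigma ->
  (forall i j, Q i j = Doob_transform P h lambda (sigma i) (sigma j)) ->
  forall n i j, mpow Q n i j =
    lambda ^- n * (h (sigma j) / h (sigma i)) * mpow P n (sigma i) (sigma j).
Proof.
move=> stochQ bij QE; have inj := bij_inj bij.
elim=> [|n IH] i j.
  rewrite /= (inj_eq inj) expr0 invr1 mul1r.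
  case: eqP => [->|_]; last by rewrite !mulr0.
  by rewrite divff ?mulr1// gt_eqF.
apply: EFin_inj; rewrite -mpowSE// EFinM -mpowSE//.
rewrite (reindex_esum _ _ sigma _ (bijective_setT_bij _ _ _ bij)).
have [M0 _] := mpow_row _ stochP n.
rewrite -esumZ; last 2 first.
- by rewrite !mulr_gt0 ?invr_gt0 ?exprn_gt0.
- by move=> k; rewrite lee_fin mulr_ge0 ?M0 ?stochastic_ge0.
apply: eq_esum => k _; rewrite -EFinM IH QE; congr EFin; rewrite /Doob_transform.
have h0 l : h l != 0 by rewrite gt_eqF.
by rewrite exprS; field; rewrite ?h0 ?expf_neq0 ?gt_eqF.
Qed.

End DoobTransform.

Theorem theorem3p4 (R : realType) (OmegaP OmegaQ : countType)
    (P : OmegaP -> OmegaP -> R) (Q : OmegaQ -> OmegaQ -> R)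
    (stochP : stochastic P) (irrP : irreducible P) (stochQ : stochastic Q) :
  Doob_equivalent Q P <->
  exists (h : OmegaP -> R) (lambda : R),
    [/\ forall i, 0 < h i, 0 < lambda, eigenfunction P h lambda
      & conjugate Q (Doob_transform P h lambda)].
Proof.
split=> [[sigma [bij iso ratio]]|[h [lambda [h_gt0 l_gt0 eig [sigma bij QP]]]]].
  have gtE := mpow_gt0_iso _ _ _ stochQ stochP bij iso.
  have [tau sK tK] := bij.
  have gtE' n i j : (0 < mpow Q n (tau i) (tau j)) = (0 < mpow P n i j).
    by rewrite gtE !tK.
  have [| |h [lambda [h_gt0 l_gt0 cE]]] := cocycle_trivial
      (fun n i j => 0 < mpow P n i j)
      (fun n i j => mpow Q n (tau i) (tau j) / mpow P n i j)
      (mpow_gt0_trans _ stochP) _ _ (irreducible_mpow_gt0 _ stochP irrP).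
  - by move=> n i j Pn; rewrite divr_gt0 ?gtE'.
  - move=> n m i j k Pn Pm.
    have Pnm := mpow_gt0_trans _ stochP _ _ _ _ _ Pn Pm.
    (* Cross-multiplied, the ratio identity is exactly the multiplicativity of the quotients of [Q]
       by [P]. *)
    have := ratio n m (tau i) (tau j) (tau k); rewrite /Gr gtE' !tK => /(_ Pnm) E.
    have Qnm0 : mpow Q (n + m) (tau i) (tau k) != 0 by rewrite gt_eqF ?gtE'.
    have Pn0 : mpow P n i j != 0 by rewrite gt_eqF.
    have Pm0 : mpow P m j k != 0 by rewrite gt_eqF.
    have Pnm0 : mpow P (n + m) i k != 0 by rewrite gt_eqF.
    rewrite mulf_div; apply/eqP; rewrite eqr_div ?mulf_neq0//; apply/eqP.
    move/eqP: E; rewrite eqr_div// => /eqP ->.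
    by rewrite mulrC.
  have QE i j : Q (tau i) (tau j) = Doob_transform P h lambda i j.
    rewrite /Doob_transform.
    have [Pij|] := boolP (0 < P i j).
      have := cE 1%N i j; rewrite !mpow1// expr1 => <-//.
      by rewrite mulfVK// gt_eqF.
    (* Off the edges the quotient says nothing, but both entries vanish. *)
    move=> nP; have nQ : ~~ (0 < Q (tau i) (tau j)).
      by rewrite -[0 < _]/(Gr Q _ _) iso !tK.
    move: nP nQ; rewrite !lt0r !stochastic_ge0// !andbT !negbK => /eqP-> /eqP->.
    by rewrite mulr0.
  exists h, lambda; split=> //.
    apply/Doob_transform_row => // i.
    case: stochQ => _ /(_ (tau i)) <-.
    have tbij : bijective tau by exists sigma.
    rewrite (reindex_esum _ _ tau _ (bijective_setT_bij _ _ _ tbij)).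
    by apply: eq_esum => j _; rewrite QE.
  by exists sigma => // i j _; rewrite -QE !sK.
(* Conjugacy gives equality on the edges of [Q] only. Elsewhere [Q] vanishes, so it is dominated by
   the transform, and equal row sums force equality everywhere. *)
have QE i j : Q i j = Doob_transform P h lambda (sigma i) (sigma j).
  move: j; apply: esum_dominated_eq => [j||].
  - rewrite stochastic_ge0//=; have [Qij|] := boolP (Gr Q i j).
      by rewrite QP.
    by rewrite -leNgt => /le_trans; apply; exact: Doob_transform_ge0.
  - by case: stochQ.
  - move/Doob_transform_row: eig => /(_ stochP h_gt0 l_gt0 (sigma i)) <-.
    by rewrite (reindex_esum _ _ sigma _ (bijective_setT_bij _ _ _ bij)).
have powE := mpow_Doob_transform _ _ _ stochP h_gt0 l_gt0 _ _ stochQ bij QE.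
have h0 l : h l != 0 by rewrite gt_eqF.
exists sigma; split=> // [i j|n m i j k].
  rewrite /Gr QE /Doob_transform pmulr_rgt0// !mulr_gt0 ?invr_gt0//.
(* The rescaling factor is positive, so the denominator of the [P] ratio is nonzero as well. *)
rewrite /Gr powE pmulr_rgt0; last by rewrite !mulr_gt0 ?invr_gt0 ?exprn_gt0.
move=> Pnm; rewrite !powE exprD.
by field; rewrite !h0 !expf_neq0 ?gt_eqF.
Qed.
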